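(* Let $\mathbb{k}$ be a field. For each integer $b\geq 1$, there exists a graph $H_b$ satisfying $$|H_b|-\gamma(H_b)+b<\operatorname{proj-dim}(H_b)<|H_b|-\epsilon(H_b)-b .$$
   Context: Graphs are finite, without loops or multiple edges; $|G|$ is the number of vertices of $G$. A set $A\subseteq V(G)$ is dominating if its closed neighbourhood $N_G[A]$ equals $V(G)$, and $\gamma(G)$ is the minimum size of a dominating set. An edge $e=xy$ edge-wise dominates a vertex $u$ if $u\in N_G[\{x,y\}]$; a set $F\subseteq E(G)$ is an edge-wise dominating set if every non-isolated vertex of $G$ is edge-wise dominated by some $f\in F$, and $\epsilon(G)$ is the minimum size of an edge-wise dominating set. For a field $\mathbb{k}$ and a graph $G$ on $V$, $\operatorname{proj-dim}(G):=\operatorname{proj-dim}(R/I_G)$, where $R=\mathbb{k}[V]$ and $I_G=(xy:xy\in E(G))$. *)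

(* Defs.v *)
From HB Require Import structures.
From mathcomp Require Import all_boot all_order all_algebra.
From mathcomp Require Import ring_quotient boolp.
From mathcomp Require Import mpoly.

Set Implicit Arguments.
Unset Strict Implicit.
Unset Printing Implicit Defensive.

Import GRing.Theory.
Local Open Scope ring_scope.

Record sgraph := SGraph {
  vertex :> finType;
  adj : rel vertex;
  adj_sym : ssrbool.symmetric adj;
  adj_irrefl : irreflexive adj
}.

Section Domination.
Variable G : sgraph.
Implicit Types (A : {set G}) (F : {set {set G}}).

Definition cl_nbhd A : {set G} :=
  A :|: [set u | [exists v in A, adj v u]].

Definition dominating A : bool := cl_nbhd A == [set: G].

(* The default set of [arg min] is itself dominating, see dominatingT. *)
Definition domination_number : nat :=
  #|[arg min_(A < [set: G] | dominating A) #|A| ]|.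

Definition edges : {set {set G}} :=
  [set [set p.1; p.2] | p : G * G & adj p.1 p.2].

Definition isolated (u : G) : bool := ~~ [exists v, adj u v].

Definition edgewise_dominating F : bool :=
  (F \subset edges) &&
  [forall u, ~~ isolated u ==> [exists e in F, u \in cl_nbhd e]].

(* As above, the default is admissible, see edgewise_dominating_edges. *)
Definition edgewise_domination_number : nat :=
  #|[arg min_(F < edges | edgewise_dominating F) #|F| ]|.

Lemma dominatingT : dominating [set: G].
Proof. by rewrite /dominating /cl_nbhd setTU. Qed.

Lemma edgewise_dominating_edges : edgewise_dominating edges.
Proof.
rewrite /edgewise_dominating subxx; apply/forallP => u; apply/implyP.
rewrite negbK => /existsP[v uv]; apply/existsP; exists [set u; v].
rewrite !inE eqxx andbT.
by apply/imsetP; exists (u, v); rewrite ?inE.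
Qed.

End Domination.

Section QuotientModule.
Variables (R : nzRingType) (V : lmodType R) (S : {pred V}).

Definition submod_pred of submod_closed S : {pred V} := S.

Hypothesis S_submod : submod_closed S.
Local Open Scope quotient_scope.

HB.instance Definition _ := GRing.isZmodClosed.Build V
  (submod_pred S_submod) (GRing.submod_closedB S_submod).

Definition quot_mod : Type := Quotient.quot (submod_pred S_submod).
HB.instance Definition _ := GRing.Zmodule.on quot_mod.

Definition quot_proj (v : V) : quot_mod :=
  \pi_(Quotient.quot (submod_pred S_submod)) v.

Definition quot_scale (a : R) (q : quot_mod) : quot_mod :=
  quot_proj (a *: repr (q : Quotient.quot (submod_pred S_submod))).

Lemma quot_projK (q : quot_mod) :
  quot_proj (repr (q : Quotient.quot (submod_pred S_submod))) = q.
Proof. exact: reprK. Qed.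

Lemma quot_proj_eq (u v : V) : (quot_proj u = quot_proj v) <-> (u - v \in S).
Proof.
have -> : (u - v \in S) = (u - v \in submod_pred S_submod) by [].
by rewrite Quotient.idealrBE; split=> /eqP.
Qed.

Lemma quot_scale_proj a v : quot_scale a (quot_proj v) = quot_proj (a *: v).
Proof.
apply/quot_proj_eq; rewrite -scalerBr.
apply: GRing.subsemimod_closedZ; first exact: GRing.submod_closed_semi.
by apply/quot_proj_eq; rewrite quot_projK.
Qed.

Lemma quot_projD u v : quot_proj (u + v) = quot_proj u + quot_proj v.
Proof. exact: raddfD. Qed.

Fact quot_scaleA a b q :
  quot_scale a (quot_scale b q) = quot_scale (a * b) q.
Proof. by rewrite -(quot_projK q) !quot_scale_proj scalerA. Qed.

Fact quot_scale1 : left_id 1 quot_scale.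
Proof. by move=> q; rewrite -(quot_projK q) quot_scale_proj scale1r. Qed.

Fact quot_scaleDr : right_distributive quot_scale +%R.
Proof.
move=> a p q; rewrite -(quot_projK p) -(quot_projK q) -quot_projD.
by rewrite !quot_scale_proj scalerDr quot_projD.
Qed.

Fact quot_scaleDl q : {morph quot_scale^~ q : a b / a + b}.
Proof.
by move=> a b; rewrite -(quot_projK q) !quot_scale_proj scalerDl quot_projD.
Qed.

HB.instance Definition _ := GRing.Zmodule_isLmodule.Build R quot_mod
  quot_scaleA quot_scale1 quot_scaleDr quot_scaleDl.

Fact quot_proj_linear : linear quot_proj.
Proof. by move=> a u v; rewrite quot_projD -quot_scale_proj. Qed.

HB.instance Definition _ :=
  GRing.isLinear.Build R V quot_mod *:%R quot_proj quot_proj_linear.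

End QuotientModule.

Section IdealGen.
Variables (R : comNzRingType) (J : finType) (P : pred J) (g : J -> R).

Definition ideal_gen : {pred R^o} :=
  fun p => `[< exists c : J -> R, p = \sum_(j | P j) c j * g j >].

Fact ideal_gen_closed : submod_closed ideal_gen.
Proof.
split=> [|a p q /asboolP[c ->] /asboolP[d ->]]; apply/asboolP.
  by exists (fun=> 0); rewrite big1 // => j _; rewrite mul0r.
exists (fun j => a * c j + d j); rewrite scaler_sumr -big_split /=.
by apply: eq_bigr => j _; rewrite mulrDl -mulrA.
Qed.

End IdealGen.

Section ProjectiveDimension.
Variable R : nzRingType.

Definition projective (P : lmodType R) : Prop :=
  forall (A B : lmodType R) (f : {linear A -> B}) (g : {linear P -> B}),
    (forall b, exists a, f a = b) ->
    exists h : {linear P -> A}, forall x, f (h x) = g x.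

(* ... -> pres 2 -> pres 1 -> pres 0 -> M -> 0 *)
Record proj_resolution (M : lmodType R) := ProjResolution {
  pres : nat -> lmodType R;
  pres_diff : forall i, {linear pres i.+1 -> pres i};
  pres_aug : {linear pres 0 -> M};
  pres_projective : forall i, projective (pres i);
  pres_aug_surj : forall m, exists x, pres_aug x = m;
  pres_exact0 : forall x, pres_aug x = 0 <-> exists y, pres_diff 0 y = x;
  pres_exactS : forall i x,
    pres_diff i x = 0 <-> exists y, pres_diff i.+1 y = x
}.

Definition has_proj_resolution_le (M : lmodType R) (d : nat) : Prop :=
  exists C : proj_resolution M, forall i, (d < i)%N -> forall x : pres C i, x = 0.

(* The projective dimension of M is finite and equal to d (for nonzero M; the
   zero module, conventionally of dimension -oo, is assigned 0 here). *)
Definition is_projdim (M : lmodType R) (d : nat) : Prop :=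
  has_proj_resolution_le M d /\
  forall d', has_proj_resolution_le M d' -> (d <= d')%N.

End ProjectiveDimension.

Section EdgeIdeal.
Variables (k : fieldType) (G : sgraph).

(* k[V], the variable of v : G being the one of index enum_rank v. *)
Definition graph_ring : comNzRingType := {mpoly k[#|G|]}.

Definition graph_var (v : G) : graph_ring := 'X_(enum_rank v).

Definition edge_ideal : {pred graph_ring^o} :=
  ideal_gen (fun p : G * G => adj p.1 p.2)
            (fun p => graph_var p.1 * graph_var p.2).

Fact edge_ideal_closed : submod_closed edge_ideal.
Proof. exact: ideal_gen_closed. Qed.

(* R / I_G *)
Definition edge_quotient : lmodType graph_ring := quot_mod edge_ideal_closed.

Definition is_graph_projdim (d : nat) : Prop := is_projdim edge_quotient d.

End EdgeIdeal.

(* Main.v *)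
From HB Require Import structures.
From mathcomp Require Import all_boot all_order all_algebra ring zify.
From mathcomp Require Import boolp ssrcomplements mpoly.
Require Import Defs.

(** Take b + 1 disjoint copies of the disjoint union of a 4-cycle and a path on 4
    vertices. One copy has 8 vertices, domination number 4 and edge-wise
    domination number 2, and its projective dimension is 3 + 2 = 5; all these
    quantities are additive, so the total projective dimension 5(b + 1) lies
    strictly between 4(b + 1) + b and 6(b + 1) - b.

    The quotient by the edge ideal is resolved by a cellular complex: the
    squarefree multidegree of a cell is a vertex set, and exactness means that
    for every vertex set W the cells inside W form a complex which is
    contractible, up to its cell of dimension 0 when W is independent. Over the
    integers these contractions are explicit for the 4-cycle (the polygon whose
    vertices are the edges of the graph, filled by one face) and for the path
    (a polygonal line), and they pass to tensor products, i.e. to disjoint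
    unions of graphs.

    The length d of such a resolution F is optimal when a basis vector t of F_d
    satisfies dt in mF_(d-1), with m the irrelevant ideal: comparing with a
    shorter resolution, the identity of F_d would factor through d, so that t
    would lie in mF_d. *)

Set Implicit Arguments.
Unset Strict Implicit.
Unset Printing Implicit Defensive.

Import GRing.Theory.
Local Open Scope ring_scope.

(** * Comparison of projective resolutions *)

(** The type varies with the index because the components of a chain map or a homotopy lie between
    different modules. *)
Lemma dependent_choice (T : nat -> Type) (r : forall i, T i -> T i.+1 -> Prop)
    (t0 : T 0) :
  (forall i t, exists t', r i t t') ->
  exists s : forall i, T i, s 0 = t0 /\ forall i, r i (s i) (s i.+1).
Proof.
move=> step.
pose s := nat_rect T t0 (fun i t => projT1 (cid (step i t))).
exists s; split=> // i.
exact: (projT2 (cid (step i (s i)))).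
Qed.

Section KernelModule.
Variables (R : nzRingType) (A B : lmodType R) (f : {linear A -> B}).

Definition in_kernel : {pred A} := fun x => f x == 0.

Fact in_kernel_closed : submod_closed in_kernel.
Proof.
split=> [|a x y /eqP fx /eqP fy]; rewrite unfold_in /in_kernel ?linear0 //.
by rewrite linearP fx fy scaler0 addr0.
Qed.

HB.instance Definition _ :=
  GRing.isSubmodClosed.Build R A in_kernel in_kernel_closed.

(** Since [projective] lifts only along surjections of modules, the kernel is made a module in its
    own right. *)
Record kernel := Kernel { kernel_val :> A; kernelP : kernel_val \in in_kernel }.
HB.instance Definition _ := [isSub for kernel_val].
HB.instance Definition _ := [Choice of kernel by <:].
HB.instance Definition _ := [SubChoice_isSubLmodule of kernel by <:].
End KernelModule.

Section Lifting.
Variables (R : nzRingType) (P A B C : lmodType R).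
Variables (f : {linear A -> B}) (g : {linear B -> C}) (phi : {linear P -> B}).

(** By exactness [f] maps onto the kernel of [g], which also contains the image of [phi];
    projectivity applies to the two corestrictions. *)
Lemma projective_lift_exact : projective P ->
    (forall b, g b = 0 <-> exists a, f a = b) ->
    (forall p, g (phi p) = 0) ->
  exists psi : {linear P -> A}, forall p, f (psi p) = phi p.
Proof.
move=> projP exact gphi.
have fK a : f a \in in_kernel g by apply/eqP/exact; exists a.
have phiK p : phi p \in in_kernel g by apply/eqP.
pose f' a : kernel g := Kernel (fK a).
pose phi' p : kernel g := Kernel (phiK p).
have f'_lin : linear f' by move=> a x y; apply/val_inj; rewrite /= !linearP.
have phi'_lin : linear phi' by move=> a x y; apply/val_inj; rewrite /= !linearP.
pose F := GRing.isLinear.Build _ _ _ _ f' f'_lin.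
pose Phi := GRing.isLinear.Build _ _ _ _ phi' phi'_lin.
pose fL : {linear A -> kernel g} := HB.pack f' F.
pose phiL : {linear P -> kernel g} := HB.pack phi' Phi.
have [b|psi psiE] := projP _ _ fL phiL.
  have /eqP/exact[a fab] := kernelP b.
  by exists a; apply/val_inj.
by exists psi => p; move: (congr1 val (psiE p)).
Qed.

End Lifting.

Section Comparison.
Variables (R : nzRingType) (M : lmodType R).
Implicit Types C D : proj_resolution M.

Lemma pres_diffK C i x : pres_diff C i (pres_diff C i.+1 x) = 0.
Proof. by apply/pres_exactS; exists x. Qed.

Lemma pres_augK C x : pres_aug C (pres_diff C 0 x) = 0.
Proof. by apply/pres_exact0; exists x. Qed.

Definition chain_map C D (f : forall i, {linear pres C i -> pres D i}) :=
  (forall x, pres_aug D (f 0 x) = pres_aug C x) /\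
  (forall i x, pres_diff D i (f i.+1 x) = f i (pres_diff C i x)).

Lemma chain_map_exists C D : exists f, @chain_map C D f.
Proof.
have [f0 f0E] := @pres_projective _ _ C 0 _ _ (pres_aug D) (pres_aug C)
  (@pres_aug_surj _ _ D).
have [|f1 f1E] := @projective_lift_exact _ _ _ _ _ (pres_diff D 0) (pres_aug D)
   (f0 \o pres_diff C 0) (@pres_projective _ _ C 1) (@pres_exact0 _ _ D).
  by move=> x /=; rewrite f0E pres_augK.
(* The recursion carries two consecutive components and their commuting square, which puts the next
   composite in a kernel. *)
pose T i := {f : {linear pres C i -> pres D i} * {linear pres C i.+1 -> pres D i.+1}
   | forall x, pres_diff D i (f.2 x) = f.1 (pres_diff C i x)}.
have step i (t : T i) : exists t' : T i.+1, (sval t').1 = (sval t).2.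
  case: t => -[f f'] /= ff'.
  have [|f'' f''E] := @projective_lift_exact _ _ _ _ _ (pres_diff D i.+1)
     (pres_diff D i) (f' \o pres_diff C i.+1) (@pres_projective _ _ C i.+2)
     (@pres_exactS _ _ D i).
    by move=> x /=; rewrite ff' pres_diffK linear0.
  by exists (exist _ (f', f'') f''E).
have [s [s0 sS]] := dependent_choice (exist _ (f0, f1) f1E : T 0) step.
exists (fun i => (sval (s i)).1); split=> [x|i x]; first by rewrite s0 f0E.
by rewrite sS (svalP (s i)).
Qed.

Definition null_homotopy C (f : forall i, {linear pres C i -> pres C i})
    (s : forall i, {linear pres C i -> pres C i.+1}) :=
  (forall x, x - f 0 x = pres_diff C 0 (s 0 x)) /\
  (forall i x, x - f i.+1 x =
     pres_diff C i.+1 (s i.+1 x) + s i (pres_diff C i x)).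

Lemma chain_map_homotopic_id C f :
  @chain_map C C f -> exists s, @null_homotopy C f s.
Proof.
move=> [f0E fE].
have [|s0 s0E] := @projective_lift_exact _ _ _ _ _ (pres_diff C 0) (pres_aug C)
   (idfun \- f 0) (@pres_projective _ _ C 0) (@pres_exact0 _ _ C).
  by move=> x /=; rewrite linearB /= f0E subrr.
(* One component is carried, together with the fact that the defect it leaves one degree higher is a
   cycle; the next component lifts this defect. *)
pose T i := {s : {linear pres C i -> pres C i.+1} |
  forall x, pres_diff C i (x - f i.+1 x - s (pres_diff C i x)) = 0}.
have t0P x : pres_diff C 0 (x - f 1 x - s0 (pres_diff C 0 x)) = 0.
  by rewrite !linearB /= s0E fE /= subrr.
have step i (t : T i) : exists t' : T i.+1, forall x, x - f i.+1 x =
    pres_diff C i.+1 (sval t' x) + sval t (pres_diff C i x).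
  case: t => s sE.
  have [|s' s'E] := @projective_lift_exact _ _ _ _ _ (pres_diff C i.+1)
     (pres_diff C i) ((idfun \- f i.+1) \- (s \o pres_diff C i))
     (@pres_projective _ _ C i.+1) (@pres_exactS _ _ C i).
    by move=> x /=; rewrite sE.
  have s'P x : pres_diff C i.+1 (x - f i.+2 x - s' (pres_diff C i.+1 x)) = 0.
    rewrite !linearB /= s'E /= fE pres_diffK (linear0 s) subr0.
    by rewrite subrr.
  by exists (exist _ s' s'P) => x /=; rewrite s'E /= subrK.
have [s [e0 sS]] := dependent_choice (exist _ s0 t0P : T 0) step.
exists (fun i => sval (s i)); split=> [x|i x]; first by rewrite e0 s0E.
exact: sS.
Qed.

Lemma chain_map_comp C D f g : @chain_map C D f -> @chain_map D C g ->
  chain_map (fun i => g i \o f i : {linear _ -> _}).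
Proof.
move=> [f0 fS] [g0 gS]; split=> [x|i x] /=; first by rewrite g0 f0.
by rewrite gS fS.
Qed.

(* The identity is homotopic to a composite C -> D -> C, which vanishes in
   degree d + 1. *)
Lemma shorter_resolution_retract C d e :
    (forall x : pres C d.+2, x = 0) -> has_proj_resolution_le M e -> (e <= d)%N ->
  exists s : {linear pres C d -> pres C d.+1},
    forall x, s (pres_diff C d x) = x.
Proof.
move=> C0 [D D0] le_ed.
have [f fP] := chain_map_exists C D; have [g gP] := chain_map_exists D C.
have [s [_ sS]] := chain_map_homotopic_id (chain_map_comp fP gP).
exists (s d) => x; move: (sS d x) => /=.
rewrite (D0 d.+1 le_ed (f d.+1 x)) (C0 (s d.+1 x)).
by rewrite (linear0 (g _)) (linear0 (pres_diff _ _)) subr0 add0r => <-.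
Qed.

End Comparison.

(** * Free modules and minimality *)

Section FreeModules.
Variable R : comNzRingType.

Definition free_mod (I : finType) : lmodType R := {ffun I -> R^o}.

Definition basis_vec (I : finType) (i : I) : free_mod I := [ffun j => (i == j)%:R].

Lemma basis_expansion (I : finType) (x : free_mod I) :
  x = \sum_i x i *: basis_vec i.
Proof.
apply/ffunP => j; rewrite sum_ffunE (bigD1 j) //= big1 => [|i ij].
  by rewrite !ffunE eqxx addr0 /GRing.scale /= mulr1.
by rewrite !ffunE (negPf ij) /GRing.scale /= mulr0.
Qed.

Lemma free_projective (I : finType) : projective (free_mod I).
Proof.
move=> A B f g fsurj.
pose a i := projT1 (cid (fsurj (g (basis_vec i)))).
have aE i : f (a i) = g (basis_vec i) := projT2 (cid (fsurj (g (basis_vec i)))).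
pose h (x : free_mod I) := \sum_i x i *: a i.
have h_lin : linear h.
  move=> c x y; rewrite /h scaler_sumr -big_split; apply: eq_bigr => i _ /=.
  by rewrite !ffunE scalerDl scalerA.
pose hM := GRing.isLinear.Build _ _ _ _ h h_lin.
pose hL : {linear free_mod I -> A} := HB.pack h hM.
exists hL => x; rewrite /= /h linear_sum [in RHS](basis_expansion x) linear_sum.
by apply: eq_bigr => i _; rewrite !linearZ /= aE.
Qed.

End FreeModules.

(** Here the polynomials vanishing at [v] play the role of the irrelevant ideal. A shorter
    resolution would give a retraction [s] with t = s(dt), whose coordinates vanish at [v]. The
    terms of [C] are abstract modules, so [phi] and [psi] supply coordinates. *)
Lemma projdim_of_minimal_top (K : fieldType) (n : nat) (M : lmodType {mpoly K[n]})
    (C : proj_resolution M) (d : nat) (I J : finType)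
    (phi : {linear free_mod {mpoly K[n]} I -> pres C d})
    (psi : {linear pres C d.+1 -> free_mod {mpoly K[n]} J})
    (t : pres C d.+1) (x : free_mod {mpoly K[n]} I) (j : J) v :
  (forall i, (d.+1 < i)%N -> forall y : pres C i, y = 0) ->
  pres_diff C d t = phi x ->
  (forall i, (x i).@[v] = 0) ->
  (psi t j).@[v] != 0 ->
  is_projdim M d.+1.
Proof.
move=> C0 dt x0 tj; split=> [|e Me]; first by exists C.
rewrite ltnNge; apply/negP => le_ed.
have [s sK] := shorter_resolution_retract (C0 d.+2 (ltnSn _)) Me le_ed.
case/eqP: tj; rewrite -(sK t) dt (basis_expansion x) !linear_sum sum_ffunE.
rewrite raddf_sum big1 //= => i _.
by rewrite !linearZ ffunE /= mevalM x0 mul0r.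
Qed.

(** * Cellular resolutions of edge ideals *)

Section MonomialExtension.
Variables (K : fieldType) (n : nat).
Implicit Types (f : 'X_{1..n} -> {mpoly K[n]}) (p q : {mpoly K[n]}).

(** Linear over [K] only: this allows maps that depend on the support of the monomial they are
    applied to. *)
Definition monomial_ext f p : {mpoly K[n]} := \sum_(m <- msupp p) p@_m *: f m.

(** A common degree bound turns sums over the supports of different polynomials into sums over one
    finite type. *)
Lemma monomial_extE f (N : nat) p : (msize p <= N)%N ->
  monomial_ext f p = \sum_(m : 'X_{1..n < N}) p@_m *: f m.
Proof.
move=> le_pN; pose I : subFinType _ := 'X_{1..n < N}.
rewrite /monomial_ext (big_mksub I) //=; first last.
- by move=> m mp; rewrite (leq_trans _ le_pN) // msize_mdeg_lt.
- exact: msupp_uniq.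
by rewrite big_rmcond //= => m /memN_msupp_eq0 ->; rewrite scale0r.
Qed.

Lemma monomial_extD f p q :
  monomial_ext f (p + q) = monomial_ext f p + monomial_ext f q.
Proof.
pose N := maxn (msize p) (maxn (msize q) (msize (p + q))).
rewrite !(@monomial_extE f N) ?leq_max ?leqnn ?orbT // -big_split /=.
by apply: eq_bigr => m _; rewrite mcoeffD scalerDl.
Qed.

Lemma monomial_ext0 f : monomial_ext f 0 = 0.
Proof. by rewrite /monomial_ext msupp0 big_nil. Qed.

Lemma monomial_extZX f (a : K) m : monomial_ext f (a *: 'X_[m]) = a *: f m.
Proof.
have [-> | a0] := eqVneq a 0; first by rewrite !scale0r monomial_ext0.
rewrite /monomial_ext (msuppMCX m a0) big_seq1.
by rewrite mcoeffZ mcoeffX eqxx mulr1.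
Qed.

End MonomialExtension.

(** * Squarefree monomials and vertex sets *)

Section SquarefreeMonomials.
Variable V : finType.

Definition set_mnm (A : {set V}) : 'X_{1..#|V|} :=
  [multinom (enum_val i \in A : nat) | i < #|V|].

Definition mnm_set (m : 'X_{1..#|V|}) : {set V} := [set v | m (enum_rank v) != 0%N].

Lemma set_mnmE A v : set_mnm A (enum_rank v) = (v \in A).
Proof. by rewrite mnmE enum_rankK. Qed.

Lemma mnm_eqP (m1 m2 : 'X_{1..#|V|}) :
  (forall v, m1 (enum_rank v) = m2 (enum_rank v)) -> m1 = m2.
Proof. by move=> eq12; apply/mnmP => i; rewrite -(enum_valK i). Qed.

Lemma set_mnm0 : set_mnm set0 = 0%MM.
Proof. by apply: mnm_eqP => v; rewrite set_mnmE inE mnm0E. Qed.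

(** Subtraction of exponents is truncated; the inclusions ensure that nothing is lost. *)
Lemma mnm_shift m (A B C : {set V}) :
    B \subset mnm_set m :|: A -> C \subset B ->
  (m + set_mnm A - set_mnm B + (set_mnm B - set_mnm C) =
    m + set_mnm A - set_mnm C)%MM.
Proof.
move=> BmA CB; apply: mnm_eqP => v; rewrite !(mnmDE, mnmBE) !set_mnmE.
have := subsetP BmA v; have := subsetP CB v; rewrite !inE.
case: (v \in A); case: (v \in B); case: (v \in C); case: (m _) => [|k] //= CvB BvA;
  first [by have := CvB isT | by have := BvA isT
        | by rewrite ?(addn0, subn0, addn1, subn1, subSS, subnn, add0n)].
Qed.

(** A term moved to another cell keeps the support of its multidegree, so the same vertex set
    governs both. *)
Lemma mnm_set_shift m (A B : {set V}) : B \subset mnm_set m :|: A ->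
  mnm_set (m + set_mnm A - set_mnm B)%MM :|: B = mnm_set m :|: A.
Proof.
move=> BmA; apply/setP => v; have := subsetP BmA v.
rewrite !inE mnmBE mnmDE !set_mnmE.
case: (v \in A); case: (v \in B); case: (m _) => [|k] //= BvA;
  first [by have := BvA isT | by rewrite ?(orbT, addn1, addn0, subn1, subn0)].
Qed.

End SquarefreeMonomials.

Definition independent (G : sgraph) (W : {set G}) : bool :=
  [forall x in W, forall y in W, ~~ adj x y].

(* [csupp c] is the squarefree multidegree of the cell [c], and the rows of [bd]
   and [contr W] are the images of the cells. [contrP] says that [contr W]
   contracts the cells inside [W] onto nothing, or onto the cell [cnil] when [W]
   is independent, i.e. when the monomials of support [W] survive in the
   quotient. By [bd_top] the boundary of [ctop] has coefficients in the
   irrelevant ideal. *)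
Record cell_complex (G : sgraph) (d : nat) := CellComplex {
  cell : finType;
  cdim : cell -> nat;
  csupp : cell -> {set G};
  bd : cell -> cell -> int;
  contr : {set G} -> cell -> cell -> int;
  cnil : cell;
  ctop : cell;
  cdim_eq0 : forall c, (cdim c == 0%N) = (c == cnil);
  csupp_nil : csupp cnil = set0;
  cdim_top : cdim ctop = d;
  cdim_le : forall c, (cdim c <= d)%N;
  bd_dim : forall a c, bd a c != 0 -> cdim a = (cdim c).+1;
  bd_supp : forall a c, bd a c != 0 -> csupp c \subset csupp a;
  bd_nil : forall a, bd a cnil != 0 -> ~~ independent (csupp a);
  bd_top : forall c, bd ctop c != 0 -> csupp c != csupp ctop;
  bd_bd : forall a c, \sum_b bd a b * bd b c = 0;
  contr_dim : forall (W : {set G}) a c, contr W a c != 0 -> cdim c = (cdim a).+1;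
  contr_supp : forall (W : {set G}) a c,
    contr W a c != 0 -> csupp a \subset W -> csupp c \subset W;
  contrP : forall (W : {set G}) a c, csupp a \subset W ->
    \sum_b contr W a b * bd b c + \sum_b bd a b * contr W b c =
    (a == c)%:Z - [&& independent W, a == cnil & c == cnil]%:Z
}.

(** * From a cell complex to a projective resolution *)

Section CellularResolution.
Variables (K : fieldType) (G : sgraph) (d : nat) (X : cell_complex G d).
Notation R := {mpoly K[#|G|]}.
Notation cell := (cell X).
Notation chain := (free_mod R cell).
Implicit Types (x y : chain) (a b c e : cell) (m : 'X_{1..#|G|}).

Definition mono_chain (k : K) m a : chain :=
  [ffun b => (k *: 'X_[m]) *+ (a == b) : R].

Lemma chain_ind (Q : chain -> Prop) :
  Q 0 -> (forall x y, Q x -> Q y -> Q (x + y)) ->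
  (forall k m a, Q (mono_chain k m a)) -> forall x, Q x.
Proof.
move=> Q0 QD Qm x.
have -> : x = \sum_a \sum_(m <- msupp (x a)) mono_chain (x a)@_m m a.
  apply/ffunP => b; rewrite sum_ffunE (bigD1 b) //= [X in _ + X]big1 => [|a ab].
    rewrite addr0 sum_ffunE [LHS]mpolyE; apply: eq_bigr => m _.
    by rewrite ffunE eqxx.
  by rewrite sum_ffunE big1 // => m _; rewrite ffunE (negPf ab).
by do 2![elim/big_ind: _ => // ? _].
Qed.

(** The homogenized boundary: the monomial factor makes every entry preserve multidegrees. All
    dimensions share one free module and are separated later. *)
Definition total_bd_fun x : chain :=
  [ffun c => \sum_b
    ((x b : R) * 'X_[set_mnm (csupp b) - set_mnm (csupp c)]) *~ bd b c : R].

Fact total_bd_linear : linear total_bd_fun.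
Proof.
move=> p x y; apply/ffunP => c; rewrite !ffunE scaler_sumr -big_split.
apply: eq_bigr => b _; rewrite !ffunE /= mulrDl mulrzDl /GRing.scale /=.
by rewrite mulrzAr mulrA.
Qed.

HB.instance Definition _ :=
  GRing.isLinear.Build R chain chain *:%R total_bd_fun total_bd_linear.

Definition total_bd : {linear chain -> chain} := total_bd_fun.

Lemma chainD x y c : (x + y) c = x c + y c.
Proof. by rewrite ffunE. Qed.

Lemma total_bd_mono k m a c : total_bd (mono_chain k m a) c =
  (k *: 'X_[m + set_mnm (csupp a) - set_mnm (csupp c)]) *~ bd a c.
Proof.
rewrite ffunE (bigD1 a) //= big1 => [|b ab]; last first.
  by rewrite ffunE eq_sym (negPf ab) mul0r mul0rz.
rewrite addr0 ffunE eqxx mulr1n -scalerAl -mpolyXD.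
have [-> | ac] := eqVneq (bd a c) 0; first by rewrite !mulr0z.
have := @mnm_shift _ m (csupp a) (csupp a) (csupp c).
by rewrite addmK => -> //; [rewrite subsetUr | exact: bd_supp ac].
Qed.

Lemma total_bdK x : total_bd (total_bd x) = 0.
Proof.
apply/ffunP => c; rewrite !ffunE.
under eq_bigr => b _ do rewrite ffunE mulr_suml mulrz_suml.
rewrite exchange_big big1 //= => a _.
rewrite (eq_bigr (fun b =>
  (x a * 'X_[set_mnm (csupp a) - set_mnm (csupp c)]) *~ (bd a b * bd b c))).
  by rewrite -mulrz_sumr bd_bd mulr0z.
move=> b _; rewrite mulrzAl -mulrzA.
have [-> | ab] := eqVneq (bd a b) 0; first by rewrite mul0r.
have [-> | bc] := eqVneq (bd b c) 0; first by rewrite mulr0.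
rewrite -mulrA -mpolyXD; congr (_ * 'X_[_] *~ _).
have := @mnm_shift _ 0%MM (csupp a) (csupp b) (csupp c).
rewrite add0m => -> //; last exact: bd_supp bc.
by rewrite subsetU // (bd_supp ab) orbT.
Qed.

(* The term X^m on the cell b has multidegree m + csupp b, of support
   W = supp m :|: csupp b; on that multidegree apply [contr W]. *)
Definition total_contr x : chain := [ffun c => \sum_b monomial_ext (fun m =>
  'X_[m + set_mnm (csupp b) - set_mnm (csupp c)] *~
     contr (mnm_set m :|: csupp b) b c) (x b) : R].

Lemma total_contrD x y : total_contr (x + y) = total_contr x + total_contr y.
Proof.
apply/ffunP => c; rewrite !ffunE -big_split; apply: eq_bigr => b _.
by rewrite ffunE monomial_extD.
Qed.

Lemma total_contr0 : total_contr 0 = 0.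
Proof.
by apply: (addrI (total_contr 0)); rewrite -total_contrD !addr0.
Qed.

Lemma total_contr_mono k m a c : total_contr (mono_chain k m a) c =
  (k *: 'X_[m + set_mnm (csupp a) - set_mnm (csupp c)]) *~
    contr (mnm_set m :|: csupp a) a c.
Proof.
rewrite ffunE (bigD1 a) //= big1 => [|b ab]; last first.
  by rewrite ffunE eq_sym (negPf ab) mulr0n monomial_ext0.
by rewrite addr0 ffunE eqxx mulr1n monomial_extZX scalerMzr.
Qed.

(** Keeps the monomials whose support contains no edge; they form a basis of the quotient by the
    edge ideal. *)
Definition indep_part (p : R) : R :=
  monomial_ext (fun m => 'X_[m] *+ independent (mnm_set m)) p.

(** The contraction is only additive, so the identity is checked on single terms. There, with [W]
    the support of the multidegree, all summands carry the same monomial and the integer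
    coefficients satisfy [contrP] for [W]. *)
Lemma total_contrP x c :
  total_bd (total_contr x) c + total_contr (total_bd x) c =
  x c - indep_part (x (cnil X)) *+ (c == cnil X).
Proof.
move: x; apply: chain_ind => [|x y IHx IHy|k m a].
- rewrite !(linear0, total_contr0) !ffunE /indep_part monomial_ext0 mul0rn.
  by rewrite addr0 subr0.
- rewrite linearD !total_contrD linearD /indep_part !chainD monomial_extD.
  by rewrite addrACA IHx IHy mulrnDl opprD addrACA.
set W := mnm_set m :|: csupp a.
have contr_bd : total_bd (total_contr (mono_chain k m a)) c =
    (k *: 'X_[m + set_mnm (csupp a) - set_mnm (csupp c)]) *~
      (\sum_b contr W a b * bd b c).
  rewrite ffunE mulrz_sumr; apply: eq_bigr => b _.
  rewrite total_contr_mono -/W mulrzAl -mulrzA.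
  have [-> | ab] := eqVneq (contr W a b) 0; first by rewrite mul0r.
  have [-> | bc] := eqVneq (bd b c) 0; first by rewrite mulr0.
  rewrite -scalerAl -mpolyXD mnm_shift //; last exact: bd_supp bc.
  by rewrite (contr_supp ab) ?subsetUr.
have bd_contr : total_contr (total_bd (mono_chain k m a)) c =
    (k *: 'X_[m + set_mnm (csupp a) - set_mnm (csupp c)]) *~
      (\sum_b bd a b * contr W b c).
  rewrite ffunE mulrz_sumr; apply: eq_bigr => b _.
  rewrite total_bd_mono scalerMzl monomial_extZX.
  have [-> | ab] := eqVneq (bd a b) 0; first by rewrite mulr0z scale0r mul0r.
  have bW : csupp b \subset W by rewrite subsetU // (bd_supp ab) orbT.
  (* With an empty third set, the shift says that the multidegree of [b] is subtracted and added
     back without loss. *)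
  have := @mnm_shift _ m (csupp a) (csupp b) set0 bW (sub0set _).
  rewrite set_mnm0 !subm0 => ->.
  by rewrite mnm_set_shift // -scalerMzr -scalerMzl -mulrzA -/W.
rewrite contr_bd bd_contr -mulrzDr contrP ?subsetUr // mulrzBr.
congr (_ - _).
  rewrite ffunE; have [-> | _] := eqVneq a c; last by rewrite mulr0z.
  by rewrite addmK.
rewrite /W ffunE; have [-> | _] /= := eqVneq a (cnil X); last first.
  by rewrite andbF mulr0z mulr0n /indep_part monomial_ext0 mul0rn.
rewrite mulr1n /indep_part monomial_extZX.
have [-> | _] := eqVneq c (cnil X); last by rewrite !andbF mulr0z mulr0n.
rewrite andbT csupp_nil setU0 set_mnm0 addm0 subm0.
by case: independent; rewrite ?mulr0z ?mulr0n ?scaler0.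
Qed.

(** * Splitting by dimension, exactness and augmentation *)

Definition gcell (i : nat) : finType := {c : cell | cdim c == i}.

Definition restr_fun i x : free_mod R (gcell i) := [ffun c => x (val c)].

Definition ext_fun i (u : free_mod R (gcell i)) : chain :=
  [ffun c => oapp u 0 (insub c)].

Fact restr_linear i : linear (restr_fun i).
Proof. by move=> p x y; apply/ffunP => c; rewrite !ffunE. Qed.

Fact ext_linear i : linear (@ext_fun i).
Proof.
move=> p u v; apply/ffunP => c; rewrite !ffunE.
by case: insubP => [c' _ _|_] /=; rewrite ?ffunE // scaler0 addr0.
Qed.

HB.instance Definition _ i := GRing.isLinear.Build R chain (free_mod R (gcell i))
  *:%R (restr_fun i) (restr_linear i).
HB.instance Definition _ i := GRing.isLinear.Build R (free_mod R (gcell i)) chain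
  *:%R (@ext_fun i) (@ext_linear i).

Definition restr i : {linear chain -> free_mod R (gcell i)} := restr_fun i.
Definition ext i : {linear free_mod R (gcell i) -> chain} := @ext_fun i.

Lemma extE i u (c : gcell i) : ext i u (val c) = u c.
Proof. by rewrite ffunE valK. Qed.

Lemma ext_out i u c : cdim c != i -> ext i u c = 0.
Proof. by move=> ci; rewrite ffunE insubN. Qed.

Lemma extK i : cancel (ext i) (restr i).
Proof. by move=> u; apply/ffunP => c; rewrite ffunE extE. Qed.

Lemma restrK i x : (forall c, cdim c != i -> x c = 0) -> ext i (restr i x) = x.
Proof.
move=> x0; apply/ffunP => c; have [ci | ci] := boolP (cdim c == i).
  by rewrite -[c]/(val (Sub c ci : gcell i)) extE ffunE.
by rewrite ext_out // x0.
Qed.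

Lemma total_bd_dim x y i c : cdim c = i ->
  (forall b, cdim b = i.+1 -> x b = y b) -> total_bd x c = total_bd y c.
Proof.
move=> ci xy; rewrite !ffunE; apply: eq_bigr => b _.
have [-> | bc] := eqVneq (bd b c) 0; first by rewrite !mulr0z.
by rewrite xy // (bd_dim bc) ci.
Qed.

Lemma total_bd_ext i u c : cdim c != i -> total_bd (ext i.+1 u) c = 0.
Proof.
move=> ci; rewrite (total_bd_dim (y := 0) erefl) ?linear0 ?ffunE // => b bc.
by rewrite ext_out ?ffunE // bc eqSS.
Qed.

Definition graded_bd i : {linear free_mod R (gcell i.+1) -> free_mod R (gcell i)} :=
  (restr i \o total_bd) \o ext i.+1.

Lemma ext_graded_bd i u : ext i (graded_bd i u) = total_bd (ext i.+1 u).
Proof. by apply: restrK => c; apply: total_bd_ext. Qed.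

Lemma graded_bd_restr i x : graded_bd i (restr i.+1 x) = restr i (total_bd x).
Proof.
apply/ffunP => c; rewrite /graded_bd /= [LHS]ffunE [RHS]ffunE.
apply: total_bd_dim (eqP (valP c)) _ => b /eqP bi.
by rewrite -[b]/(val (Sub b bi : gcell i.+1)) extE ffunE.
Qed.

(** A cycle is the boundary of its contraction, because the correction term on [cnil] vanishes in
    positive dimension. *)
Lemma graded_bd_exact i u :
  graded_bd i u = 0 <-> exists v, graded_bd i.+1 v = u.
Proof.
split=> [u0 | [v <-]]; last first.
  by apply: (can_inj (@extK _)); rewrite !ext_graded_bd total_bdK linear0.
exists (restr i.+2 (total_contr (ext i.+1 u))); rewrite graded_bd_restr -[RHS]extK.
congr (restr _ _); apply/ffunP => c.
have := total_contrP (ext i.+1 u) c.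
rewrite -ext_graded_bd u0 linear0 total_contr0.
have -> : ext i.+1 u (cnil X) = 0.
  by rewrite ext_out // (eqP (_ : cdim (cnil X) == 0%N)) ?cdim_eq0.
by rewrite /indep_part monomial_ext0 mul0rn subr0 (ffunE (fun=> 0)) addr0.
Qed.

Lemma nil_dim : cdim (cnil X) == 0%N.
Proof. by rewrite cdim_eq0. Qed.

(** The only cell of dimension 0, so the resolution starts with a free module of rank one. *)
Definition gnil : gcell 0 := Sub (cnil X) nil_dim.

Lemma gcell0 (c : gcell 0) : c = gnil.
Proof. by apply/val_inj/eqP; rewrite /= -cdim_eq0 (valP c). Qed.

Definition unit_chain (p : R) : free_mod R (gcell 0) := [ffun=> p].

Notation quot := (@quot_proj _ _ _ (edge_ideal_closed K G)).

Definition augmentation_fun (u : free_mod R (gcell 0)) : edge_quotient K G :=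
  quot (u gnil).

Fact augmentation_linear : linear augmentation_fun.
Proof. by move=> p u v; rewrite /augmentation_fun !ffunE linearP. Qed.

HB.instance Definition _ := GRing.isLinear.Build R (free_mod R (gcell 0))
  (edge_quotient K G) *:%R augmentation_fun augmentation_linear.

Definition augmentation : {linear free_mod R (gcell 0) -> edge_quotient K G} :=
  augmentation_fun.

Lemma augmentation_surj q : exists u, augmentation u = q.
Proof.
exists (unit_chain
  (repr (q : Quotient.quot (submod_pred (edge_ideal_closed K G))))).
by rewrite -[RHS](quot_projK q) /= /augmentation_fun ffunE.
Qed.

Lemma augmentation_eq0 (u : free_mod R (gcell 0)) :
  augmentation u = 0 <-> u gnil \in @edge_ideal K G.
Proof.
by rewrite -[0](linear0 (quot)) quot_proj_eq subr0.
Qed.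

Lemma graph_varM (u v : G) :
  graph_var K u * graph_var K v = 'X_[U_(enum_rank u) + U_(enum_rank v)] :> R.
Proof. by rewrite mpolyXD. Qed.

Lemma indep_part_sum (I : Type) (r : seq I) (P : pred I) (F : I -> R) :
  indep_part (\sum_(i <- r | P i) F i) = \sum_(i <- r | P i) indep_part (F i).
Proof. exact: (big_morph _ (monomial_extD _) (monomial_ext0 _)). Qed.

Lemma indep_part_edge_ideal (p : R) : p \in @edge_ideal K G -> indep_part p = 0.
Proof.
move=> /asboolP[q ->]; rewrite indep_part_sum big1 // => -[u v] /= uv.
rewrite [q _]mpolyE mulr_suml indep_part_sum big1_seq // => m _.
rewrite graph_varM -scalerAl -mpolyXD /indep_part monomial_extZX.
rewrite (_ : independent _ = false) ?mulr0n ?scaler0 //.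
have um : u \in mnm_set (m + (U_(enum_rank u) + U_(enum_rank v)))%MM.
  by rewrite inE !mnmDE !mnm1E eqxx -lt0n !addn_gt0 /= orbT.
have vm : v \in mnm_set (m + (U_(enum_rank u) + U_(enum_rank v)))%MM.
  by rewrite inE !mnmDE !mnm1E eqxx -lt0n !addn_gt0 /= !orbT.
by apply/negP => /forall_inP/(_ u um)/forall_inP/(_ v vm); rewrite uv.
Qed.

Lemma nonface_edge_ideal (W : {set G}) :
  ~~ independent W -> ('X_[set_mnm W] : R) \in @edge_ideal K G.
Proof.
rewrite negb_forall_in => /exists_inP[u uW]; rewrite negb_forall_in.
move=> /exists_inP[v vW]; rewrite negbK => uv; apply/asboolP.
exists (fun j => 'X_[set_mnm (W :\ u :\ v)] *+ (j == (u, v))).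
rewrite (bigD1 (u, v)) //= big1 => [|j /andP[_ /negPf ->]]; last first.
  by rewrite mulr0n mul0r.
rewrite eqxx mulr1n addr0 graph_varM -mpolyXD; congr 'X_[_].
apply: mnm_eqP => w; rewrite !mnmDE !mnm1E !set_mnmE !inE !(inj_eq enum_rank_inj).
have uv' : u != v by apply: contraTneq uv => ->; rewrite adj_irrefl.
have [-> | wv] := eqVneq w v; first by rewrite vW (negPf uv').
have [-> | wu] := eqVneq w u; first by rewrite uW. 
by rewrite !addn0.
Qed.

Lemma quotM (p q : R) : quot (p * q) = (p : graph_ring K G) *: quot q.
Proof.
exact: esym (quot_scale_proj (edge_ideal_closed K G) p q).
Qed.

(** The contraction works again for [u] in the ideal, which [indep_part] kills. Conversely, a
    boundary coefficient on [cnil] comes from monomials of supports that are not independent, by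
    [bd_nil]. *)
Lemma graded_bd_aug (u : free_mod R (gcell 0)) :
  u gnil \in @edge_ideal K G <-> exists v, graded_bd 0 v = u.
Proof.
split=> [uI | [v <-]].
  exists (restr 1 (total_contr (ext 0 u))); rewrite graded_bd_restr -[RHS]extK.
  congr (restr _ _); apply/ffunP => c.
  have := total_contrP (ext 0 u) c.
  have -> : total_bd (ext 0 u) = 0.
    apply/ffunP => e; rewrite [RHS]ffunE (total_bd_dim (y := 0) erefl).
      by rewrite linear0 ffunE.
    by move=> b be; rewrite ext_out ?be // ffunE.
  rewrite -[cnil X]/(val gnil) extE indep_part_edge_ideal // mul0rn subr0.
  by rewrite total_contr0 (ffunE (fun=> 0)) addr0.
apply/augmentation_eq0; rewrite /augmentation /= /augmentation_fun.
rewrite -[graded_bd 0 v gnil]extE ext_graded_bd ffunE linear_sum big1 // => b _.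
rewrite raddfMz; have [-> | b0] := eqVneq (bd b (val gnil)) 0.
  by rewrite mulr0z.
rewrite /= quotM.
have -> : quot 'X_[set_mnm (csupp b) - set_mnm (csupp (cnil X))] = 0.
  rewrite csupp_nil set_mnm0 subm0 -(linear0 quot); apply/quot_proj_eq.
  by rewrite subr0 nonface_edge_ideal // (bd_nil b0).
by rewrite scaler0 mul0rz.
Qed.

Definition cellular_resolution : proj_resolution (edge_quotient K G) :=
  @ProjResolution (graph_ring K G) (edge_quotient K G)
    (fun i => free_mod R (gcell i)) graded_bd augmentation
    (fun i => @free_projective _ _) augmentation_surj
    (fun u => iff_trans (augmentation_eq0 u) (graded_bd_aug u))
    graded_bd_exact.

Lemma cell_complex_projdim : (0 < d)%N -> is_graph_projdim K G d.
Proof.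
move=> d_gt0; have topP : cdim (ctop X) == d.-1.+1 by rewrite prednK // cdim_top.
pose top : gcell d.-1.+1 := Sub (ctop X) topP.
rewrite /is_graph_projdim -(prednK d_gt0).
(* The test point is the origin, where exactly the polynomials of the irrelevant ideal vanish. *)
apply: (@projdim_of_minimal_top K _ _ cellular_resolution _ _ _ idfun idfun
  (basis_vec R top) (graded_bd d.-1 (basis_vec R top)) top (fun=> 0)) => //.
- move=> i; rewrite prednK // => lt_di u; apply/ffunP => c.
  by have := cdim_le (val c); rewrite (eqP (valP c)) leqNgt lt_di.
- move=> c; rewrite -extE ext_graded_bd.
  rewrite (total_bd_dim (y := mono_chain 1 0%MM (ctop X)) (eqP (valP c))).
    rewrite total_bd_mono; have [-> | b0] := eqVneq (bd (ctop X) (val c)) 0.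
      by rewrite mulr0z meval0.
    (* The variable of [v] occurs with exponent one in the coefficient, which therefore vanishes at
       the origin. *)
    have /subsetPn[v vt vc] : ~~ (csupp (ctop X) \subset csupp (val c)).
      apply: contra (bd_top b0) => tc.
      by rewrite eqEsubset tc andbT (bd_supp b0).
    rewrite raddfMz /= mevalZ mevalX (bigD1 (enum_rank v)) //=.
    rewrite mnmBE mnmDE mnm0E !set_mnmE vt (negPf vc) subn0 expr1.
    by rewrite mul0r mulr0 mul0rz.
  move=> b /eqP bd; rewrite -[b]/(val (Sub b bd : gcell d.-1.+1)) extE !ffunE.
  by rewrite mpolyX0 scale1r -val_eqE.
by rewrite ffunE eqxx meval1 oner_neq0.
Qed.

End CellularResolution.

(** * Disjoint unions *)

Section DisjointUnion.
Variables G H : sgraph.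

Definition union_adj : rel (G + H) := fun u v =>
  match u, v with
  | inl x, inl y => adj x y
  | inr x, inr y => adj x y
  | _, _ => false
  end.

Fact union_adj_sym : ssrbool.symmetric union_adj.
Proof. by move=> [x | x] [y | y] //=; rewrite adj_sym. Qed.

Fact union_adj_irrefl : irreflexive union_adj.
Proof. by move=> [x | x] /=; rewrite adj_irrefl. Qed.

Definition graph_union : sgraph := SGraph union_adj_sym union_adj_irrefl.

Definition sum_set (A : {set G}) (B : {set H}) : {set graph_union} :=
  [set v : G + H | match v with inl x => x \in A | inr y => y \in B end].
Definition lset (W : {set graph_union}) : {set G} := [set x | inl x \in W].
Definition rset (W : {set graph_union}) : {set H} := [set y | inr y \in W].

Lemma sum_set_sub A B (W : {set graph_union}) :
  (sum_set A B \subset W) = (A \subset lset W) && (B \subset rset W).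
Proof.
apply/subsetP/andP => [AB | [/subsetP AW /subsetP BW] [x | y]]; last 2 first.
- by rewrite inE => /AW; rewrite inE.
- by rewrite inE => /BW; rewrite inE.
by split; apply/subsetP => v vA; rewrite inE; apply: AB; rewrite inE.
Qed.

Lemma sum_setK1 A B : lset (sum_set A B) = A.
Proof. by apply/setP => x; rewrite !inE. Qed.

Lemma sum_setK2 A B : rset (sum_set A B) = B.
Proof. by apply/setP => x; rewrite !inE. Qed.

Lemma independent_union (W : {set graph_union}) :
  independent W = independent (lset W) && independent (rset W).
Proof.
apply/idP/andP => [indW | [indL indR]].
  by split; apply/forall_inP => x; rewrite inE => xW; apply/forall_inP => y;
    rewrite inE => yW; have /forall_inP/(_ _ xW)/forall_inP/(_ _ yW) := indW.
apply/forall_inP => -[x | x] xW; apply/forall_inP => -[y | y] yW //=.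
  have /forall_inP/(_ x) := indL; rewrite inE => /(_ xW)/forall_inP/(_ y).
  by rewrite inE => /(_ yW).
have /forall_inP/(_ x) := indR; rewrite inE => /(_ xW)/forall_inP/(_ y).
by rewrite inE => /(_ yW).
Qed.

End DisjointUnion.

(** * Integer matrices indexed by finite types *)

Section IndexedMatrices.
Implicit Types I J : finType.

Definition imul I (A B : I -> I -> int) a c := \sum_b A a b * B b c.
Definition iadd I (A B : I -> I -> int) a c := A a c + B a c.
Definition idiag I (s : I -> int) a c : int := s a * (a == c)%:Z.
Definition itens I J (A : I -> I -> int) (B : J -> J -> int) (a c : I * J) :=
  A a.1 c.1 * B a.2 c.2.

Lemma imulDl I (A B C : I -> I -> int) a c :
  imul (iadd A B) C a c = imul A C a c + imul B C a c.
Proof. by rewrite -big_split; apply: eq_bigr => b _ /=; rewrite mulrDl. Qed.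

Lemma imulDr I (A B C : I -> I -> int) a c :
  imul A (iadd B C) a c = imul A B a c + imul A C a c.
Proof. by rewrite -big_split; apply: eq_bigr => b _ /=; rewrite mulrDr. Qed.

Lemma imul_tens I J (A A' : I -> I -> int) (B B' : J -> J -> int) a c :
  imul (itens A B) (itens A' B') a c = itens (imul A A') (imul B B') a c.
Proof.
rewrite /imul /itens [RHS]big_distrlr pair_bigA.
by apply: eq_bigr => b _; rewrite mulrACA.
Qed.

Lemma imul_diagl I s (A : I -> I -> int) a c : imul (idiag s) A a c = s a * A a c.
Proof.
rewrite /imul (bigD1 a) //= big1 => [|b ab]; rewrite /idiag.
  by rewrite eqxx mulr1 addr0.
by rewrite eq_sym (negPf ab) mulr0 mul0r.
Qed.

Lemma imul_diagr I s (A : I -> I -> int) a c : imul A (idiag s) a c = A a c * s c.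
Proof.
rewrite /imul (bigD1 c) //= big1 => [|b ab]; rewrite /idiag.
  by rewrite eqxx mulr1 addr0.
by rewrite (negPf ab) !mulr0.
Qed.

End IndexedMatrices.

(** * Tensor products of cell complexes *)

Section TensorComplex.
Variables (G H : sgraph) (d e : nat) (X : cell_complex G d) (Y : cell_complex H e).
Notation ucell := (cell X * cell Y)%type.
Implicit Types (a c : ucell).

Definition tdim a := (cdim a.1 + cdim a.2)%N.
Definition tsupp a : {set graph_union G H} := sum_set (csupp a.1) (csupp a.2).
(** The Koszul sign. *)
Definition tsign (a : cell X) : int := (-1) ^+ cdim a.
Definition tbd : ucell -> ucell -> int :=
  iadd (itens (@bd _ _ X) (idiag (fun=> 1))) (itens (idiag tsign) (@bd _ _ Y)).
Definition nil_proj (W : {set G}) (a c : cell X) : int :=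
  [&& independent W, a == cnil X & c == cnil X]%:Z.
(* With h, h' the contractions of the factors and p the projection onto [cnil],
   the contraction of the tensor product is h (x) 1 + p (x) h'. *)
Definition tcontr (W : {set graph_union G H}) : ucell -> ucell -> int :=
  iadd (itens (contr (lset W)) (idiag (fun=> 1)))
       (itens (nil_proj (lset W)) (contr (rset W))).
Definition tnil : ucell := (cnil X, cnil Y).
Definition ttop : ucell := (ctop X, ctop Y).

(** A nonzero entry moves only one factor, so conditions on dimensions and supports are inherited
    factor by factor. *)
Lemma tbd_neq0 a c : tbd a c != 0 ->
  (bd a.1 c.1 != 0) && (a.2 == c.2) || (a.1 == c.1) && (bd a.2 c.2 != 0).
Proof.
apply: contraR; rewrite negb_or !negb_and !negbK => /andP[A B].
rewrite /tbd /iadd /itens /idiag; apply/eqP.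
case/orP: A => [/eqP -> | /negPf ->]; case/orP: B => [/negPf -> | /eqP ->];
  by rewrite ?(mulr0, mul0r, addr0).
Qed.

Lemma tcontr_neq0 (W : {set graph_union G H}) a c : tcontr W a c != 0 ->
  (contr (lset W) a.1 c.1 != 0) && (a.2 == c.2)
  || [&& a.1 == cnil X, c.1 == cnil X & contr (rset W) a.2 c.2 != 0].
Proof.
apply: contraR; rewrite negb_or !negb_and !negbK => /andP[A B].
rewrite /tcontr /iadd /itens /idiag /nil_proj; apply/eqP.
case/orP: A => [/eqP -> | /negPf ->];
  case/or3P: B => [/negPf -> | /negPf -> | /eqP ->];
  by rewrite ?(andbF, mulr0, mul0r, addr0).
Qed.

Lemma cnil_dim (G' : sgraph) d' (Z : cell_complex G' d') : cdim (cnil Z) = 0%N.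
Proof. by apply/eqP; rewrite cdim_eq0. Qed.

Lemma bd_nil_eq0 (G' : sgraph) d' (Z : cell_complex G' d') (c : cell Z) :
  bd (cnil Z) c = 0.
Proof. by apply/eqP/contraT => /bd_dim; rewrite cnil_dim. Qed.

Lemma tdim_eq0 a : (tdim a == 0%N) = (a == tnil).
Proof. by rewrite addn_eq0 !cdim_eq0 -pair_eqE. Qed.

Lemma tsupp_nil : tsupp tnil = set0.
Proof. by apply/setP => -[x | x]; rewrite !inE /= csupp_nil inE. Qed.

Lemma tdim_top : tdim ttop = (d + e)%N.
Proof. by rewrite /tdim !cdim_top. Qed.

Lemma tdim_le a : (tdim a <= d + e)%N.
Proof. by rewrite leq_add ?cdim_le. Qed.

Lemma tbd_dim a c : tbd a c != 0 -> tdim a = (tdim c).+1.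
Proof.
case/tbd_neq0/orP => /andP[]; rewrite /tdim.
  by move=> /bd_dim -> /eqP ->.
by move=> /eqP -> /bd_dim ->; rewrite addnS.
Qed.

Lemma tsupp_sub a (W : {set graph_union G H}) : (tsupp a \subset W) =
  (csupp a.1 \subset lset W) && (csupp a.2 \subset rset W).
Proof. exact: sum_set_sub. Qed.

Lemma tbd_supp a c : tbd a c != 0 -> tsupp c \subset tsupp a.
Proof.
rewrite tsupp_sub sum_setK1 sum_setK2.
case/tbd_neq0/orP => /andP[].
  by move=> /bd_supp -> /eqP ->; rewrite subxx.
by move=> /eqP -> /bd_supp ->; rewrite subxx.
Qed.

Lemma tbd_nil a : tbd a tnil != 0 -> ~~ independent (tsupp a).
Proof.
rewrite independent_union sum_setK1 sum_setK2 negb_and.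
case/tbd_neq0/orP => /andP[]; first by move=> /bd_nil ->.
by move=> _ /bd_nil ->; rewrite orbT.
Qed.

Lemma tbd_top c : tbd ttop c != 0 -> tsupp c != tsupp ttop.
Proof.
case/tbd_neq0/orP => /andP[A B]; apply/eqP => eq_supp.
  move/(congr1 (@lset G H))/eqP: eq_supp; rewrite !sum_setK1.
  by apply/negP/bd_top.
move/(congr1 (@rset G H))/eqP: eq_supp; rewrite !sum_setK2.
by apply/negP/bd_top.
Qed.

(** The squares vanish in each factor, and the mixed terms cancel because the sign flips with the
    dimension. *)
Lemma tbd_tbd a c : \sum_b tbd a b * tbd b c = 0.
Proof.
rewrite -/(imul tbd tbd a c) /tbd imulDl !imulDr !imul_tens /itens.
rewrite !imul_diagl !imul_diagr /imul !bd_bd !(mulr0, mul0r) addr0 add0r.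
rewrite mulr1 mul1r -mulrDl.
have [-> | /bd_dim ac] := eqVneq (bd a.1 c.1) 0.
  by rewrite !(mul0r, mulr0, addr0).
by rewrite /tsign ac exprS mulN1r mulNr (mulrC (bd a.1 c.1)) subrr mul0r.
Qed.

Lemma tcontr_dim (W : {set graph_union G H}) a c :
  tcontr W a c != 0 -> tdim c = (tdim a).+1.
Proof.
case/tcontr_neq0/orP; rewrite /tdim.
  by case/andP => /contr_dim -> /eqP ->.
by case/and3P => /eqP -> /eqP -> /contr_dim ->; rewrite addnS.
Qed.

Lemma tcontr_supp (W : {set graph_union G H}) a c :
  tcontr W a c != 0 -> tsupp a \subset W -> tsupp c \subset W.
Proof.
move=> ac; rewrite !tsupp_sub => /andP[aL aR]; case/tcontr_neq0/orP: ac.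
  by case/andP => /contr_supp/(_ aL) -> /eqP <-.
by case/and3P => _ /eqP -> /contr_supp/(_ aR) ->; rewrite csupp_nil sub0set.
Qed.

Lemma independentS (G' : sgraph) (A B : {set G'}) :
  A \subset B -> independent B -> independent A.
Proof.
move=> /subsetP AB /forall_inP indB; apply/forall_inP => x /AB/indB/forall_inP indx.
by apply/forall_inP => y /AB/indx.
Qed.

(** Write s for the sign. From pd = dp = 0, ps = sp = p and hs + sh = 0, the sum reduces to (hd +
    dh) (x) 1 + p (x) (h'd' + d'h'), which is (1 - p) (x) 1 + p (x) (1 - p') = 1 - p (x) p'. *)
Lemma tcontrP (W : {set graph_union G H}) a c : tsupp a \subset W ->
  \sum_b tcontr W a b * tbd b c + \sum_b tbd a b * tcontr W b c =
  (a == c)%:Z - [&& independent W, a == tnil & c == tnil]%:Z.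
Proof.
rewrite tsupp_sub => /andP[aL aR].
rewrite -/(imul (tcontr W) tbd a c) -/(imul tbd (tcontr W) a c).
rewrite /tbd /tcontr !(imulDl, imulDr) !imul_tens /itens.
rewrite !imul_diagl !imul_diagr.
have nil_bd : imul (nil_proj (lset W)) (@bd _ _ X) a.1 c.1 = 0.
  rewrite /imul big1 // => b _; rewrite /nil_proj.
  have [-> | _] := eqVneq b (cnil X); last by rewrite !andbF mul0r.
  by rewrite bd_nil_eq0 mulr0.
(* If [lset W] is independent, no cell inside it has a boundary on [cnil]. *)
have bd_nilp : imul (@bd _ _ X) (nil_proj (lset W)) a.1 c.1 = 0.
  rewrite /imul big1 // => b _; rewrite /nil_proj.
  have [-> | _] := eqVneq b (cnil X); last by rewrite !andbF mulr0.
  have [-> | /bd_nil dep] := eqVneq (bd a.1 (cnil X)) 0; first by rewrite mul0r.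
  by rewrite (contraNF (independentS aL) dep) mulr0.
have anticomm :
    contr (lset W) a.1 c.1 * tsign c.1 + tsign a.1 * contr (lset W) a.1 c.1 = 0.
  have [-> | /contr_dim ac] := eqVneq (contr (lset W) a.1 c.1) 0.
    by rewrite mul0r mulr0 addr0.
  by rewrite /tsign ac exprS mulN1r mulrN mulrC addNr.
have nil_sign_r : nil_proj (lset W) a.1 c.1 * tsign c.1 = nil_proj (lset W) a.1 c.1.
  rewrite /nil_proj /tsign; have [-> | _] := eqVneq c.1 (cnil X).
    by rewrite cnil_dim expr0 mulr1.
  by rewrite !andbF mul0r.
have nil_sign_l : tsign a.1 * nil_proj (lset W) a.1 c.1 = nil_proj (lset W) a.1 c.1.
  rewrite /nil_proj /tsign; have [-> | _] := eqVneq a.1 (cnil X).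
    by rewrite cnil_dim expr0 mul1r.
  by rewrite andbF mulr0.
rewrite nil_bd bd_nilp nil_sign_r nil_sign_l.
have := contrP c.1 aL; have := contrP c.2 aR.
rewrite -/(imul _ _ a.1 c.1) -/(imul _ _ a.1 c.1) -/(imul _ _ a.2 c.2).
rewrite -/(imul _ _ a.2 c.2) -/(nil_proj _ _ _).
set HD1 := imul (contr _) _ a.1 c.1; set DH1 := imul _ (contr _) a.1 c.1.
set HD2 := imul (contr _) _ a.2 c.2; set DH2 := imul _ (contr _) a.2 c.2.
set p := nil_proj _ _ _ => e2 e1.
transitivity ((HD1 + DH1) * (a.2 == c.2)%:Z + p * (HD2 + DH2) +
  (contr (lset W) a.1 c.1 * tsign c.1 + tsign a.1 * contr (lset W) a.1 c.1) *
    bd a.2 c.2).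
  by rewrite /idiag; ring.
rewrite anticomm e1 e2 mul0r addr0 independent_union -!pair_eqE /p /nil_proj /=.
by do 8!case: (_ == _) || case: (independent _).
Qed.

Definition tensor_complex : cell_complex (graph_union G H) (d + e) :=
  CellComplex tdim_eq0 tsupp_nil tdim_top tdim_le tbd_dim tbd_supp tbd_nil
    tbd_top tbd_tbd tcontr_dim tcontr_supp tcontrP.

End TensorComplex.

(** * Domination numbers of disjoint unions *)

Section DominationUnion.
Variables G H : sgraph.

Lemma card_union_set (A : {set graph_union G H}) :
  #|A| = (#|lset A| + #|rset A|)%N.
Proof.
rewrite -!sum1_card big_sumType /=.
by congr (_ + _)%N; apply: eq_bigl => v; rewrite inE.
Qed.

(** No edge joins the two parts, so each vertex is dominated from within its own part. *)
Lemma dominating_union (A : {set graph_union G H}) :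
  dominating A -> dominating (lset A) && dominating (rset A).
Proof.
move=> /eqP domA; apply/andP; split; apply/eqP/setP => v; rewrite !inE.
  have := in_setT (inl v : graph_union G H); rewrite -domA !inE.
  case: (inl v \in A) => //= /exists_inP[[w | w] wA //= wv].
  by apply/exists_inP; exists w; rewrite ?inE.
have := in_setT (inr v : graph_union G H); rewrite -domA !inE.
case: (inr v \in A) => //= /exists_inP[[w | w] wA //= wv].
by apply/exists_inP; exists w; rewrite ?inE.
Qed.

Lemma domination_number_min (A : {set G}) :
  dominating A -> (domination_number G <= #|A|)%N.
Proof.
rewrite /domination_number; case: arg_minnP; first exact: dominatingT.
by move=> B _ minB /minB.
Qed.

Lemma edgewise_domination_number_min (F : {set {set G}}) :
  edgewise_dominating F -> (edgewise_domination_number G <= #|F|)%N.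
Proof.
rewrite /edgewise_domination_number.
case: arg_minnP; first exact: edgewise_dominating_edges.
by move=> B _ minB /minB.
Qed.

End DominationUnion.

Lemma domination_number_witness (G : sgraph) :
  exists2 A : {set G}, dominating A & #|A| = domination_number G.
Proof.
rewrite /domination_number; case: arg_minnP; first exact: dominatingT.
by move=> A domA _; exists A.
Qed.

Lemma edgewise_domination_number_witness (G : sgraph) :
  exists2 F : {set {set G}}, edgewise_dominating F &
    #|F| = edgewise_domination_number G.
Proof.
rewrite /edgewise_domination_number.
case: arg_minnP; first exact: edgewise_dominating_edges.
by move=> F domF _; exists F.
Qed.

Lemma domination_number_union (G H : sgraph) :
  (domination_number G + domination_number H <=
   domination_number (graph_union G H))%N.
Proof.
have [A domA <-] := domination_number_witness (graph_union G H).
rewrite card_union_set; case/andP: (dominating_union domA) => dL dR.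
by rewrite leq_add ?domination_number_min.
Qed.

Lemma edgewise_domination_number_union (G H : sgraph) :
  (edgewise_domination_number (graph_union G H) <=
   edgewise_domination_number G + edgewise_domination_number H)%N.
Proof.
have [E1 /andP[E1e /forallP E1d] <-] := edgewise_domination_number_witness G.
have [E2 /andP[E2e /forallP E2d] <-] := edgewise_domination_number_witness H.
pose F1 := [set @sum_set G H e set0 | e in E1].
pose F2 := [set @sum_set G H set0 e | e in E2].
apply: (@leq_trans #|F1 :|: F2|); last first.
  rewrite (leq_trans (leq_card_setU _ _)) //.
  by rewrite leq_add ?leq_imset_card.
apply: edgewise_domination_number_min; apply/andP; split.
  apply/subsetP => f; rewrite inE => /orP[] /imsetP[e eE ->].
    have /imsetP[[x y] /=] := subsetP E1e _ eE; rewrite inE => xy ->.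
    apply/imsetP; exists (inl x : graph_union G H, inl y : graph_union G H);
      first by rewrite inE.
    by apply/setP => -[v | v]; rewrite !inE.
  have /imsetP[[x y] /=] := subsetP E2e _ eE; rewrite inE => xy ->.
  apply/imsetP; exists (inr x : graph_union G H, inr y : graph_union G H);
    first by rewrite inE.
  by apply/setP => -[v | v]; rewrite !inE.
apply/forallP => -[u | u]; apply/implyP; rewrite negbK => /existsP[[v | v] //= uv].
  have /implyP := E1d u; rewrite negbK => /(_ _)/exists_inP[|e eE].
    by apply/existsP; exists v.
  rewrite !inE => ue; apply/exists_inP; exists (sum_set e set0).
    by apply/setUP; left; apply: imset_f.
  rewrite !inE; case/orP: ue => [-> // | /exists_inP[w we wu]].
  by apply/orP; right; apply/exists_inP; exists (inl w); rewrite ?inE.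
have /implyP := E2d u; rewrite negbK => /(_ _)/exists_inP[|e eE].
  by apply/existsP; exists v.
rewrite !inE => ue; apply/exists_inP; exists (sum_set set0 e).
  by apply/setUP; right; apply: imset_f.
rewrite !inE; case/orP: ue => [-> // | /exists_inP[w we wu]].
by apply/orP; right; apply/exists_inP; exists (inr w); rewrite ?inE.
Qed.

Lemma edgewise_domination_number_le1 (G : sgraph) (x y : G) : adj x y ->
  (forall u, [|| u == x, u == y, adj x u | adj y u]) ->
  (edgewise_domination_number G <= 1)%N.
Proof.
move=> xy dom_xy; rewrite -(cards1 [set x; y]).
apply: edgewise_domination_number_min; apply/andP; split.
  by rewrite sub1set; apply/imsetP; exists (x, y); rewrite ?inE.
apply/forallP => u; apply/implyP => _; apply/exists_inP; exists [set x; y].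
  by rewrite inE.
rewrite !inE; case/or4P: (dom_xy u) => [-> // | -> | xu | yu]; rewrite ?orbT //.
  by apply/orP; right; apply/exists_inP; exists x; rewrite // !inE eqxx.
by apply/orP; right; apply/exists_inP; exists y; rewrite // !inE eqxx orbT.
Qed.

(** * Complexes given by computable tables *)

Section Tables.
Variable n : nat.

Definition bits (W : {set 'I_n}) : bitseq := [seq v \in W | v <- enum 'I_n].

Lemma nth_bits W (v : 'I_n) : nth false (bits W) v = (v \in W).
Proof. by rewrite (nth_map v) ?size_enum_ord // nth_ord_enum. Qed.

Lemma count_bits W : count id (bits W) = #|W|.
Proof. by rewrite count_map cardE [enum W]/enum_mem size_filter enumT. Qed.

Fixpoint all_bits k : seq bitseq :=
  if k is k'.+1 then
    [seq true :: w | w <- all_bits k'] ++ [seq false :: w | w <- all_bits k']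
  else [:: [::]].

Lemma mem_all_bits w : w \in all_bits (size w).
Proof.
elim: w => // x w IHw /=; rewrite mem_cat.
by case: x; rewrite map_f ?orbT.
Qed.

Lemma bits_all_bits W : bits W \in all_bits n.
Proof. by have := mem_all_bits (bits W); rewrite size_map size_enum_ord. Qed.

Definition all_ord k (P : nat -> bool) := all P (iota 0 k).

Lemma all_ordP k (P : nat -> bool) : reflect (forall i : 'I_k, P i) (all_ord k P).
Proof.
apply: (iffP allP) => [allP i | allP i]; first by rewrite allP // mem_iota /=.
by rewrite mem_iota /= => lt_ik; have := allP (Ordinal lt_ik).
Qed.

Definition sum_ord k (F : nat -> int) : int :=
  foldr (fun i s => F i + s) 0 (iota 0 k).

Lemma sum_ordE k F : sum_ord k F = \sum_(i < k) F i.
Proof.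
rewrite -(big_mkord xpredT) /index_iota subn0 /sum_ord.
by elim: (iota 0 k) => [|i r IHr] /=; rewrite ?big_nil ?big_cons // IHr.
Qed.

End Tables.

(* Cells are numbered 0, ..., m; the cell 0 is the empty one and m is the top one.
   The tables are functions on nat and bit sequences so that [table_check] can
   be evaluated. *)
Section TableComplex.
Variables (n m d : nat) (e : rel nat).
Variables (dim : nat -> nat) (supp : nat -> nat -> bool) (B : nat -> nat -> int).
Variable (C : bitseq -> nat -> nat -> int).

Definition table_graph_check :=
  all_ord n (fun x => ~~ e x x && all_ord n (fun y => e x y == e y x)).

Definition table_independent (w : nat -> bool) :=
  all_ord n (fun x => w x ==> all_ord n (fun y => w y ==> ~~ e x y)).

Definition table_subset (w w' : nat -> bool) := all_ord n (fun v => w v ==> w' v).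

(** Existence of a neighbour is phrased as a negated universal test, so that [all_ord] serves both
    quantifiers. *)
Definition table_dominating (w : nat -> bool) :=
  all_ord n (fun v => w v || ~~ all_ord n (fun u => ~~ (w u && e u v))).

Definition table_check :=
  [&& all_ord m.+1 (fun a => (dim a == 0%N) == (a == 0%N)),
      table_subset (supp 0%N) (fun=> false),
      dim m == d,
      all_ord m.+1 (fun a => (dim a <= d)%N),
      all_ord m.+1 (fun a => (B a 0 != 0) ==> ~~ table_independent (supp a)),
      all_ord m.+1 (fun c => (B m c != 0) ==> ~~ table_subset (supp m) (supp c)) &
      all_ord m.+1 (fun a => all_ord m.+1 (fun c =>
        [&& (B a c != 0) ==> (dim a == (dim c).+1),
            (B a c != 0) ==> table_subset (supp c) (supp a),
            sum_ord m.+1 (fun b => B a b * B b c) == 0 &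
            all (fun w => let W := nth false w in
              [&& (C w a c != 0) ==> (dim c == (dim a).+1),
                  (C w a c != 0) ==> table_subset (supp a) W ==>
                    table_subset (supp c) W &
                  table_subset (supp a) W ==>
                    (sum_ord m.+1 (fun b => C w a b * B b c) +
                     sum_ord m.+1 (fun b => B a b * C w b c) ==
                     (a == c)%:Z - [&& table_independent W, a == 0 & c == 0]%N%:Z)])
              (all_bits n)]))].

Hypothesis graphP : table_graph_check.

Definition table_adj : rel 'I_n := fun x y => e x y.

Fact table_adj_sym : ssrbool.symmetric table_adj.
Proof.
move=> x y; move/all_ordP: graphP => /(_ x)/andP[_ /all_ordP/(_ y)].
by move/eqP.
Qed.

Fact table_adj_irrefl : irreflexive table_adj.
Proof. by move=> x; move/all_ordP: graphP => /(_ x)/andP[/negPf]. Qed.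

Definition table_graph : sgraph := SGraph table_adj_sym table_adj_irrefl.

Definition table_set (w : nat -> bool) : {set table_graph} := [set v : 'I_n | w v].

Lemma table_setE (W : {set table_graph}) : table_set (nth false (bits W)) = W.
Proof. by apply/setP => v; rewrite inE nth_bits. Qed.

Lemma table_subsetE w w' : table_subset w w' = (table_set w \subset table_set w').
Proof.
apply/all_ordP/subsetP => [ww v | ww v].
  by rewrite !inE; apply/implyP/ww.
by have := ww v; rewrite !inE => ?; apply/implyP.
Qed.

Lemma table_independentE w : table_independent w = independent (table_set w).
Proof.
apply/all_ordP/forall_inP => [indw x | indw x].
  rewrite inE => wx; apply/forall_inP => y; rewrite inE => wy.
  have /implyP/(_ wx)/all_ordP/(_ y) := indw x.
  by move/implyP/(_ wy).
apply/implyP => wx; apply/all_ordP => y; apply/implyP => wy.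
by have := indw x; rewrite inE => /(_ wx)/forall_inP/(_ y); rewrite inE; apply.
Qed.

Lemma table_domination k :
  all (fun w => table_dominating (nth false w) ==> (k <= count id w)%N)
    (all_bits n) ->
  (k <= domination_number table_graph)%N.
Proof.
have [A domA <-] := domination_number_witness table_graph.
move/allP => /(_ _ (bits_all_bits A)) /implyP; rewrite count_bits; apply.
apply/all_ordP => v; move/eqP/setP/(_ v): domA; rewrite !inE nth_bits.
case: (v \in A) => //= /exists_inP[u uA uv]; apply/negP => /all_ordP/(_ u).
by rewrite nth_bits uA (uv : e u v : bool).
Qed.

Section Check.
Hypothesis checkP : table_check.

Lemma table_complex : cell_complex table_graph d.
Proof.
case/and5P: checkP => /all_ordP dim0 supp0 /eqP dimm /all_ordP dimd.
case/and3P => /all_ordP B0 /all_ordP Bm Call.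
have {}Call a c := all_ordP _ _ (all_ordP _ _ Call a) c.
(* Every vertex set occurs among the tested bit sequences. *)
have CW (a c : 'I_m.+1) (W : {set table_graph}) :=
  let: And4 _ _ _ CW := and4P (Call a c) in allP CW _ (bits_all_bits W).
pose S (a : 'I_m.+1) := table_set (supp a).
pose cntr (W : {set table_graph}) (a c : 'I_m.+1) := C (bits W) a c.
apply: (@CellComplex table_graph d 'I_m.+1 dim S B cntr ord0 ord_max).
- by move=> c; rewrite (eqP (dim0 c)).
- apply/eqP; rewrite -subset0; move: supp0; rewrite table_subsetE.
  by apply: subset_trans; apply/subsetP => v; rewrite inE.
- by [].
- exact: dimd.
- by move=> a c ac; case/and4P: (Call a c) => /implyP/(_ ac)/eqP.
- move=> a c ac; case/and4P: (Call a c) => _ /implyP/(_ ac).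
  by rewrite table_subsetE.
- by move=> a a0; have /implyP/(_ a0) := B0 a; rewrite table_independentE.
- move=> c mc; have /implyP/(_ mc) := Bm c; rewrite table_subsetE.
  by apply: contra => /eqP eqS; rewrite -[table_set (supp c)]/(S c) eqS.
- by move=> a c; case/and4P: (Call a c) => _ _ /eqP; rewrite sum_ordE.
- by move=> W a c ac; case/and3P: (CW a c W) => /implyP/(_ ac)/eqP.
- move=> W a c ac; case/and3P: (CW a c W) => _ /implyP/(_ ac).
  by rewrite !table_subsetE table_setE => /implyP.
move=> W a c; case/and3P: (CW a c W) => _ _; rewrite !table_subsetE table_setE.
move=> /implyP aW /aW/eqP.
by rewrite !sum_ordE table_independentE table_setE.
Qed.

End Check.
End TableComplex.

(** * The 4-cycle, the path and their copies *)

Section FourCycle.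
Local Open Scope nat_scope.

Definition c4_rel : rel nat := fun x y => (y == x.+1 %% 4) || (x == y.+1 %% 4).

(* Cell 0 is empty; cell i + 1 is the edge {i, i + 1} for i < 4; cell i + 5 is the
   path i, i + 1, i + 2, which joins the edges {i, i + 1} and {i + 1, i + 2};
   cell 9 is the polygon bounded by these four paths. *)
Definition c4_dim c :=
  if c is 0 then 0 else if c < 5 then 1 else if c < 9 then 2 else 3.

(** The path i, i + 1, i + 2 omits the vertex i + 3, which is c - 2 modulo 4 for c = i + 5. *)
Definition c4_supp c v :=
  if c is 0 then false else if c < 5 then (v == c.-1) || (v == c %% 4)
  else if c < 9 then v != (c - 2) %% 4 else true.

(** The boundary of a path is its first edge minus its second; around the cycle these cancel, so the
    sum of the four paths can bound the polygon. *)
Definition c4_bd a c : int :=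
  if a is 0 then 0%R else if a < 5 then (c == 0)%:Z
  else if a < 9 then ((c == a - 4)%N%:Z - (c == ((a - 4) %% 4).+1)%N%:Z)%R
  else (4 < c < 9)%:Z.

(* The edges inside [w] form a run of consecutive edges starting at [root], and
   an edge is sent to minus the sum of the paths leading to it from [root]. If
   [w] is everything the run closes up at the last path, cell 8, which is sent
   to the polygon. *)
Definition c4_contr (w : bitseq) a c : int :=
  let inside b := all (fun v => c4_supp b v ==> nth false w v) (iota 0 4) in
  let full := all id w in
  let root := if full then 1 else
    find (fun b => [&& 0 < b < 5, inside b & ~~ inside (if b == 1 then 4 else b.-1)])
         (iota 0 5) in
  if a is 0 then ((c < 5) && (c == root))%:Z
  else if a < 5 then
    (- [&& 4 < c < 9, inside c & (c - root) %% 4 < (a + 4 - root) %% 4]%N%:Z)%R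
  else if a == 8 then (full && (c == 9))%:Z else 0%R.

Lemma c4_graphP : table_graph_check 4 c4_rel.
Proof. by vm_compute. Qed.

Lemma c4_check : table_check 4 9 3 c4_rel c4_dim c4_supp c4_bd c4_contr.
Proof. by vm_compute. Qed.

End FourCycle.

Section FourPath.
Local Open Scope nat_scope.

Definition p4_rel : rel nat := fun x y => (y == x.+1) || (x == y.+1).

(* Cell 0 is empty; cells 1, 2, 3 are the edges {i, i + 1}; cells 4, 5 are the
   paths on three vertices. *)
Definition p4_dim c := if c is 0 then 0 else if c < 4 then 1 else 2.

Definition p4_supp c v :=
  if c is 0 then false else if c < 4 then c.-1 <= v <= c else c - 4 <= v <= c - 2.

Definition p4_bd a c : int :=
  if a is 0 then 0%R else if a < 4 then (c == 0)%:Z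
  else ((c == a - 3)%N%:Z - (c == a - 2)%N%:Z)%R.

(** The edges inside [w] are consecutive from [root] on, and an edge goes to minus the sum of the
    paths from [root] to it. If there is none, [find] returns 4, which [c < 4] rejects: the empty
    cell then goes to 0, as an independent set requires. *)
Definition p4_contr (w : bitseq) a c : int :=
  let inside b := all (fun v => p4_supp b v ==> nth false w v) (iota 0 4) in
  let root := find (fun b => (0 < b) && inside b) (iota 0 4) in
  if a is 0 then ((c < 4) && (c == root))%:Z
  else if a < 4 then (- [&& 3 < c, inside c & c - 3 < a]%N%:Z)%R
  else 0%R.

Lemma p4_graphP : table_graph_check 4 p4_rel.
Proof. by vm_compute. Qed.

Lemma p4_check : table_check 4 5 2 p4_rel p4_dim p4_supp p4_bd p4_contr.
Proof. by vm_compute. Qed.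

End FourPath.

Definition c4_p4 : sgraph :=
  graph_union (table_graph c4_graphP) (table_graph p4_graphP).

Fixpoint c4_p4_copies (b : nat) : sgraph :=
  if b is b'.+1 then graph_union c4_p4 (c4_p4_copies b') else c4_p4.

Lemma c4_p4_complex : cell_complex c4_p4 5.
Proof.
exact: tensor_complex (table_complex c4_graphP c4_check)
                      (table_complex p4_graphP p4_check).
Qed.

Lemma c4_p4_copies_complex b : cell_complex (c4_p4_copies b) (5 * b.+1).
Proof.
elim: b => [|b IHb]; first exact: c4_p4_complex.
by rewrite mulnS; apply: tensor_complex c4_p4_complex IHb.
Qed.

Lemma c4_p4_domination : (4 <= domination_number c4_p4)%N.
Proof.
apply: leq_trans (domination_number_union _ _).
(* No single vertex dominates either graph; all 16 vertex sets are tested for each. *)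
by apply: (@leq_add 2 2); apply: table_domination; vm_compute.
Qed.

Lemma c4_p4_edgewise : (edgewise_domination_number c4_p4 <= 2)%N.
Proof.
apply: leq_trans (edgewise_domination_number_union _ _) _.
apply: (@leq_add _ _ 1 1).
  (* Any edge of the cycle would do; for the path it must be the middle one. *)
  apply: (@edgewise_domination_number_le1 (table_graph c4_graphP)
    (Ordinal (isT : 0 < 4)%N) (Ordinal (isT : 1 < 4)%N)) => //.
  by case=> [[|[|[|[|]]]]].
apply: (@edgewise_domination_number_le1 (table_graph p4_graphP)
  (Ordinal (isT : 1 < 4)%N) (Ordinal (isT : 2 < 4)%N)) => //.
by case=> [[|[|[|[|]]]]].
Qed.

Lemma card_c4_p4_copies b : #|c4_p4_copies b| = (8 * b.+1)%N.
Proof.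
have c8 : #|c4_p4| = 8%N by rewrite card_sum !card_ord.
by elim: b => [|b IHb] //; rewrite mulnS card_sum c8 IHb.
Qed.

Lemma c4_p4_copies_domination b :
  (4 * b.+1 <= domination_number (c4_p4_copies b))%N.
Proof.
elim: b => [|b IHb]; first exact: c4_p4_domination.
rewrite mulnS; apply: leq_trans (domination_number_union _ _).
exact: leq_add c4_p4_domination IHb.
Qed.

Lemma c4_p4_copies_edgewise b :
  (edgewise_domination_number (c4_p4_copies b) <= 2 * b.+1)%N.
Proof.
elim: b => [|b IHb]; first exact: c4_p4_edgewise.
rewrite mulnS; apply: leq_trans (edgewise_domination_number_union _ _) _.
exact: leq_add c4_p4_edgewise IHb.
Qed.

Theorem proposition5p10 (k : fieldType) (b : nat) (hb : (1 <= b)%N) :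
  exists (H : sgraph) (pd : nat),
    is_graph_projdim k H pd /\
    #|H|%:Z - (domination_number H)%:Z + b%:Z < pd%:Z /\
    pd%:Z < #|H|%:Z - (edgewise_domination_number H)%:Z - b%:Z.
Proof.
exists (c4_p4_copies b), (5 * b.+1)%N; split.
  by apply: cell_complex_projdim (c4_p4_copies_complex b) _.
have := c4_p4_copies_domination b; have := c4_p4_copies_edgewise b.
rewrite card_c4_p4_copies.
(* With b + 1 copies the bounds leave a margin of one on each side: 5(b + 1) = 4(b + 1) + b + 1 =
   6(b + 1) - b - 1. *)
move: (domination_number _) (edgewise_domination_number _) => g e; lia.
Qed.
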